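(* Let $\mathbb{T}$ be a time scale with $0,1\in\mathbb{T}$. Consider the problem of minimizing $$\mathcal{L}[u_1,u_2]=\int_0^1\left((u_1(t))^2+(u_2(t))^2\right)\Delta t$$ subject to the control system $$x_1^{\Delta}(t)=\exp(u_1(t))+u_1(t)+u_2(t),\qquad x_2^{\Delta}(t)=u_2(t),$$ the boundary conditions $$x_1(0)=0,\quad x_1(1)=2,\quad x_2(0)=0,\quad x_2(1)=1,$$ and the control constraints $u_1(t),u_2(t)\in[-1,1]$. Then the global minimum value of $\mathcal{L}$ is $1$, and an absolute (global) minimizer is given by $$\tilde u_1(t)=0,\quad \tilde u_2(t)=1,\quad \tilde x_1(t)=2t,\quad \tilde x_2(t)=t .$$
   Context: A time scale $\mathbb{T}$ is a nonempty closed subset of $\mathbb{R}$, with the topology inherited from $\mathbb{R}$. The forward jump operator is $\sigma(t)=\inf\{s\in\mathbb{T}:s>t\}$ for $t<\sup\mathbb{T}$, with $\sigma(\sup\mathbb{T})=\sup\mathbb{T}$ if $\sup\mathbb{T}<+\infty$. The backward jump operator is $\rho(t)=\sup\{s\in\mathbb{T}:s<t\}$ for $t>\inf\mathbb{T}$, with $\rho(\inf\mathbb{T})=\inf\mathbb{T}$ if $\inf\mathbb{T}>-\infty$. A point $t$ is right-dense if $\sigma(t)=t$, left-dense if $\rho(t)=t$, left-scattered if $\rho(t)<t$. If $\sup\mathbb{T}$ is finite and left-scattered, $\mathbb{T}^{\kappa}=\mathbb{T}\setminus\{\sup\mathbb{T}\}$; otherwise $\mathbb{T}^\kappa=\mathbb{T}$.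 The interval $[0,1]$ of times means $[0,1]\cap\mathbb{T}$, itself regarded as a time scale (so $[0,1]^\kappa$ is defined accordingly); the control set $[-1,1]$ is the ordinary real interval. The delta derivative of $f$ at $t\in\mathbb{T}^{\kappa}$ is the real number $f^{\Delta}(t)$ such that for every $\varepsilon>0$ there is a neighborhood $U=(t-\delta,t+\delta)\cap\mathbb{T}$ with $|f(\sigma(t))-f(s)-f^{\Delta}(t)(\sigma(t)-s)|\le\varepsilon|\sigma(t)-s|$ for all $s\in U$. A function $g$ is piecewise rd-continuous if it is defined except possibly at finitely many points, is continuous at the right-dense points of its domain, has finite left-sided limits at left-dense points, and has finite right-sided limits at right-dense exceptional points. $C^1_{prd}([0,1],\mathbb{R})$ is the set of continuous $f:[0,1]\to\mathbb{R}$ such that $f^{\Delta}$ exists for all except possibly finitely many $t\in[0,1]^{\kappa}$ and $f^{\Delta}$ is piecewise rd-continuous. The delta integral of a piecewise rd-continuous $f$ is $\int_c^d f(t)\Delta t=F(d)-F(c)$, where $F$ is continuous and $F^{\Delta}=f$ except possibly at finitely many points. The admissible processes are those with states $x_1,x_2\in C^1_{prd}([0,1],\mathbb{R})$ and piecewise rd-continuous controls $u_1,u_2$ on $[0,1]^{\kappa}$ with values in $[-1,1]$, satisfying the control system for all except possibly finitely many $t\in[0,1]^{\kappa}$ and the boundary conditions.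
   Formalization: The finitely many exceptional points in the control system and in the delta integral must be right-dense; otherwise the claim fails, e.g. for T={0,1} the system could be ignored at 0, giving cost 0 with zero controls and an ill-defined integral. *)

(* Defs.v *)
From mathcomp Require Import all_boot all_order all_algebra.
From mathcomp Require Import all_classical all_reals all_analysis.

Set Implicit Arguments.
Unset Strict Implicit.
Unset Printing Implicit Defensive.

Import Order.TTheory GRing.Theory Num.Theory.
Import numFieldNormedType.Exports.

Local Open Scope classical_set_scope.
Local Open Scope ring_scope.

Definition time_scale (R : realType) (T : set R) : Prop :=
  T !=set0 /\ closed T.

(* For t in T, having a point of T beyond t means exactly t < sup T; the else
   branches are the conventions at the maximum and the minimum of T. *)
Definition sigma (R : realType) (T : set R) (t : R) : R :=
  if `[< exists s, T s /\ t < s >] then inf [set s | T s /\ t < s] else t.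

Definition rho (R : realType) (T : set R) (t : R) : R :=
  if `[< exists s, T s /\ s < t >] then sup [set s | T s /\ s < t] else t.

Definition right_dense (R : realType) (T : set R) (t : R) : Prop :=
  sigma T t = t.

Definition left_dense (R : realType) (T : set R) (t : R) : Prop :=
  rho T t = t.

Definition left_scattered (R : realType) (T : set R) (t : R) : Prop :=
  rho T t < t.

Definition kappa (R : realType) (T : set R) : set R :=
  if `[< has_ubound T /\ left_scattered T (sup T) >]
  then T `\ sup T else T.

Definition ts_interval (R : realType) (T : set R) (a b : R) : set R :=
  T `&` `[a, b].

(* [l] is the delta derivative of [f] at [t]; meant for [t] in [kappa T]. *)
Definition is_delta_derive (R : realType) (T : set R) (f : R -> R) (t l : R) :
    Prop :=
  forall e : R, 0 < e -> \forall s \near t, T s ->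
    `|f (sigma T t) - f s - l * (sigma T t - s)| <= e * `|sigma T t - s|.

(* Partial real functions; the values of [pval] outside [pdom] are junk. *)
Record pfun (R : realType) := PFun { pdom : set R ; pval :> R -> R }.

Definition delta_derive (R : realType) (T : set R) (f : R -> R) : pfun R :=
  PFun [set t | kappa T t /\ exists l, is_delta_derive T f t l]
       (fun t => xget 0 [set l | is_delta_derive T f t l]).

(* At min T, which satisfies [left_dense T], and at max T, which satisfies
   [right_dense T], the one-sided limit conditions hold vacuously. *)
Definition prd_continuous (R : realType) (T : set R) (g : pfun R) : Prop :=
  [/\ pdom g `<=` kappa T,
      finite_set (kappa T `\` pdom g),
      forall t, pdom g t -> right_dense T t ->
        g s @[s --> within (pdom g) (nbhs t)] --> g t,
      forall t, kappa T t -> left_dense T t ->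
        exists l : R, g s @[s --> within (pdom g) t^'-] --> l
    & forall t, (kappa T `\` pdom g) t -> right_dense T t ->
        exists l : R, g s @[s --> within (pdom g) t^'+] --> l].

(* The existence of the delta derivative off a finite subset of [kappa T] is
   the second clause of [prd_continuous T (delta_derive T f)]. *)
Definition C1prd (R : realType) (T : set R) (f : R -> R) : Prop :=
  {within T, continuous f} /\ prd_continuous T (delta_derive T f).

(* "For all except possibly finitely many t in T^kappa", the exceptional points
   being right-dense.  At a right-scattered t, a delta derivative fixes the jump
   from t to sigma(t): were such points allowed as exceptions, delta integrals
   would not be well defined, and on a finite time scale a differential equation
   would be no constraint at all. *)
Definition nearly_everywhere (R : realType) (T : set R) (P : R -> Prop) : Prop :=
  finite_set (kappa T `&` [set t | ~ P t]) /\
  kappa T `&` [set t | ~ P t] `<=` right_dense T.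

Definition is_delta_integral (R : realType) (T : set R) (g : pfun R)
    (c d v : R) : Prop :=
  exists F : R -> R,
    [/\ {within T, continuous F},
        nearly_everywhere T
          (fun t => pdom g t /\ is_delta_derive T F t (g t))
      & v = F d - F c].

Definition delta_integral (R : realType) (T : set R) (g : pfun R) (c d : R) : R :=
  xget 0 [set v | is_delta_integral T g c d v].

Definition cost (R : realType) (T : set R) (u1 u2 : pfun R) : R :=
  delta_integral (ts_interval T 0 1)
    (PFun (pdom u1 `&` pdom u2) (fun t => u1 t ^+ 2 + u2 t ^+ 2)) 0 1.

(* The states are functions on [ts_interval T 0 1]: their values elsewhere play
   no role. *)
Definition admissible (R : realType) (T : set R)
    (x1 x2 : R -> R) (u1 u2 : pfun R) : Prop :=
  let I := ts_interval T 0 1 in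
  [/\ C1prd I x1 /\ C1prd I x2,
      prd_continuous I u1 /\ prd_continuous I u2,
      (forall t, pdom u1 t -> -1 <= u1 t <= 1) /\
      (forall t, pdom u2 t -> -1 <= u2 t <= 1),
      nearly_everywhere I (fun t =>
        [/\ pdom u1 t, pdom u2 t,
            is_delta_derive I x1 t (expR (u1 t) + u1 t + u2 t)
          & is_delta_derive I x2 t (u2 t)])
    & [/\ x1 0 = 0, x1 1 = 2, x2 0 = 0 & x2 1 = 1]].

(* Main.v *)
Require Import Defs.
From mathcomp Require Import all_boot all_order all_algebra.
From mathcomp Require Import all_classical all_reals all_analysis.
From mathcomp Require Import ring lra.

Import Order.TTheory GRing.Theory Num.Theory.
Import numFieldNormedType.Exports.

Local Open Scope classical_set_scope.
Local Open Scope ring_scope.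

(** The cost density dominates a density whose integral is prescribed by the
    boundary conditions: u1 ^+ 2 + u2 ^+ 2 - (2 * u2 - 1) is a sum of two
    squares, and 2 * u2 - 1 is nearly everywhere the delta derivative of
    2 * x2 t - t, whose increment over [0, 1] is 2 * 1 - 1 = 1 for every
    admissible process.  The bound is an equality when u1 = 0 and u2 = 1.

    Two facts about the delta calculus turn this into a proof.

    Integrals are monotone [delta_increment_le]: this follows from
    [delta_derive_ge0_homo], by which a continuous function with nonnegative
    delta derivative off a finite set of right-dense points is nondecreasing.
    In particular delta integrals are unique.

    The cost of an admissible process is a genuine integral
    [delta_integral_sqr_exists].  Since [delta_integral] returns 0 when there is
    no antiderivative, the lower bound 1 would be false without this existence
    theorem.  It rests on [mean_primitive]: on a set of times with a least
    element, a bounded function g has a primitive F whose mean slope over [s, t) lies between the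
    bounds of g on [s, t).  Such an F is the pointwise supremum of the functions
    that satisfy the upper half of this condition.  At a right-scattered point t
    the only time in [t, sigma t) is t itself, so the mean slope is exactly g t;
    at a right-dense point of continuity it tends to g t. *)

(** * Finite sets of reals *)

Lemma finite_isolated (R : realType) (A : set R) (a : R) : finite_set A ->
  exists2 d, 0 < d & forall y, `|a - y| < d -> y != a -> ~ A y.
Proof.
move=> fA.
have cA : closed (A `\ a).
  have /accessible_finite_set_closed := hausdorff_accessible (@Rhausdorff R).
  by apply; exact: finite_setD.
have oA : open (~` (A `\ a)) by rewrite openC.
have /nbhs_ballP[d d0 dA] : nbhs a (~` (A `\ a)).
  by apply: open_nbhs_nbhs; split=> // -[_ /(_ erefl)].
exists d => // y ay ya Ay; apply: (dA _ ay); split=> // y_eq.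
by rewrite y_eq eqxx in ya.
Qed.

Lemma avoid_finite (R : realType) (A : set R) (a b : R) :
  finite_set A -> a < b -> exists y, [/\ a < y, y < b & ~ A y].
Proof.
move=> fA ab; have [d d0 dA] := finite_isolated R A a fA.
have m0 : 0 < Num.min d (b - a) by rewrite lt_min d0 subr_gt0.
have [md mb] : Num.min d (b - a) <= d /\ Num.min d (b - a) <= b - a.
  by rewrite !ge_min !lexx orbT.
set m := Num.min d (b - a) in m0 md mb.
exists (a + m / 2); split; [lra | lra | apply: dA].
  by rewrite opprD addNKr normrN ger0_norm; lra.
by rewrite gt_eqF //; lra.
Qed.

(** * Jump operators *)

Section jumps.
Context {R : realType}.
Implicit Types (T : set R) (t s d : R).

Lemma sigma_ge T t : t <= sigma T t.
Proof.
rewrite /sigma; case: asboolP => // -[s Ts].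
by apply: lb_le_inf; [exists s | move=> r [_ /ltW]].
Qed.

Lemma sigma_le T t s : T s -> t < s -> sigma T t <= s.
Proof.
move=> Ts ts; rewrite /sigma; case: asboolP => [_|[]]; last by exists s.
by apply: ge_inf => //; exists t => r [_ /ltW].
Qed.

Lemma sigma_approx T t b d : T b -> t < b -> 0 < d ->
  exists s, [/\ T s, t < s, s <= b & s < sigma T t + d].
Proof.
move=> Tb tb d0.
have ex : exists s, T s /\ t < s by exists b.
have [] := @inf_adherent R [set s | T s /\ t < s] d d0.
  by split; [exists b | exists t => r [_ /ltW]].
move=> s [Ts ts] sd; have [sb|bs] := leP s b.
  by exists s; rewrite /sigma asboolT.
by exists b; rewrite /sigma asboolT //; split=> //; exact: lt_trans sd.
Qed.

Lemma rho_approx T t a d : T a -> a < t -> 0 < d ->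
  exists s, [/\ T s, s < t & rho T t - d < s].
Proof.
move=> Ta at0 d0.
have ex : exists s, T s /\ s < t by exists a.
have [] := @sup_adherent R [set s | T s /\ s < t] d d0.
  by split; [exists a | exists t => r [_ /ltW]].
by move=> s [Ts ts] sd; exists s; rewrite /rho asboolT.
Qed.

Lemma closed_approx T t : closed T ->
  (forall d, 0 < d -> exists2 s, T s & `|t - s| < d) -> T t.
Proof.
move=> cT h; rewrite (closure_id T).1 // => U /nbhs_ballP [d d0 dU].
by have [s Ts st] := h d d0; exists s; split=> //; exact: dU.
Qed.

Lemma sigma_in T t : closed T -> T t -> T (sigma T t).
Proof.
move=> cT Tt; have [[b [Tb tb]]|no] := pselect (exists s, T s /\ t < s); last first.
  by rewrite /sigma asboolF.
apply: closed_approx => // d d0.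
have [s [Ts ts sb sd]] := sigma_approx T t b d Tb tb d0.
have le_s := sigma_le T t s Ts ts.
by exists s => //; rewrite ler0_norm; lra.
Qed.

(** Only the maximum can be missing from [kappa T]. *)
Lemma kappa_lt T t b : T t -> T b -> t < b -> kappa T t.
Proof.
move=> Tt Tb tb; rewrite /kappa; case: asboolP => // -[ubT _]; split=> // t_eq.
by have := ub_le_sup ubT Tb; rewrite -t_eq leNgt tb.
Qed.

Lemma kappa_sub T : kappa T `<=` T.
Proof. by rewrite /kappa; case: asboolP => [_ t []|_ t]. Qed.

(** The only point that [kappa] can remove is a left-scattered maximum, so a
    maximum that survives is left-dense; this is what makes the delta derivative
    unique there. *)
Lemma kappa_max_left_dense T t : kappa T t -> (forall s, T s -> s <= t) ->
  t <= rho T t.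
Proof.
move=> kt tmax; have Tt := kappa_sub T t kt.
have ubT : has_ubound T by exists t.
have supt : sup T = t.
  apply/eqP; rewrite eq_le (ub_le_sup ubT Tt) andbT.
  by apply: ge_sup => //; exists t.
rewrite leNgt; apply/negP => rt.
move: kt; rewrite /kappa asboolT /=; last by rewrite /left_scattered supt.
by case=> _; apply; rewrite supt.
Qed.

End jumps.

(** * Properties that hold nearly everywhere *)

Section nearly_everywhere_theory.
Context {R : realType}.
Implicit Types (T : set R) (P Q : R -> Prop).

Lemma nearly_everywhereS T P Q : (forall t, kappa T t -> P t -> Q t) ->
  nearly_everywhere T P -> nearly_everywhere T Q.
Proof.
move=> PQ [finP rdP].
have sub : kappa T `&` [set t | ~ Q t] `<=` kappa T `&` [set t | ~ P t].
  by move=> t [kt nQ]; split=> // Pt; apply: nQ; exact: PQ.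
by split; [exact: sub_finite_set sub finP | exact: subset_trans sub rdP].
Qed.

Lemma nearly_everywhereT T P : (forall t, kappa T t -> P t) ->
  nearly_everywhere T P.
Proof.
move=> kP; rewrite /nearly_everywhere.
have -> : kappa T `&` [set t | ~ P t] = set0.
  by apply/seteqP; split=> // t [/kP].
by split=> // t.
Qed.

Lemma nearly_everywhereI T P Q : nearly_everywhere T P ->
  nearly_everywhere T Q -> nearly_everywhere T (fun t => P t /\ Q t).
Proof.
move=> [finP rdP] [finQ rdQ].
have sub : kappa T `&` [set t | ~ (P t /\ Q t)] `<=`
    (kappa T `&` [set t | ~ P t]) `|` (kappa T `&` [set t | ~ Q t]).
  move=> t [kt nPQ]; have [Pt|nP] := pselect (P t); last by left.
  by right; split=> // Qt; exact: nPQ.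
split; first by apply: sub_finite_set sub _; rewrite finite_setU.
by move=> t /sub[/rdP|/rdQ].
Qed.

End nearly_everywhere_theory.

(** * The delta derivative *)

Lemma withinP (R : realType) (A : set R) (f : R -> R) (t l : R) :
  (f s @[s --> within A (nbhs t)] --> l) <->
  (forall e, 0 < e -> exists2 d, 0 < d &
     forall s, `|t - s| < d -> A s -> `|l - f s| < e).
Proof.
split=> [/cvgrPdist_lt h e e0|h].
  by have /nbhs_ballP[d d0 dh] := h e e0; exists d => // s; exact: dh.
apply/cvgrPdist_lt => e e0; have [d d0 dh] := h e e0.
by apply/nbhs_ballP; exists d => // s; exact: dh.
Qed.

Section delta.
Context {R : realType}.
Implicit Types (T : set R) (f : R -> R) (t l : R).

Lemma is_delta_deriveP T f t l :
  is_delta_derive T f t l <->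
  (forall e, 0 < e -> exists2 d, 0 < d & forall s, `|t - s| < d -> T s ->
     `|f (sigma T t) - f s - l * (sigma T t - s)| <= e * `|sigma T t - s|).
Proof.
split=> h e e0; first by have /nbhs_ballP[d d0 dh] := h e e0; exists d.
by have [d d0 dh] := h e e0; apply/nbhs_ballP; exists d.
Qed.

Lemma is_delta_derive_linear T (c t : R) :
  is_delta_derive T (fun s => c * s) t c.
Proof.
apply/is_delta_deriveP => e e0; exists 1 => // s _ _.
by rewrite -mulrBr subrr normr0 mulr_ge0 // ltW.
Qed.

Lemma is_delta_deriveD T f g t l m :
  is_delta_derive T f t l -> is_delta_derive T g t m ->
  is_delta_derive T (fun s => f s + g s) t (l + m).
Proof.
move=> /is_delta_deriveP hf /is_delta_deriveP hg; apply/is_delta_deriveP => e e0.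
have e20 : 0 < e / 2 by lra.
have [d1 d10 h1] := hf _ e20; have [d2 d20 h2] := hg _ e20.
exists (Num.min d1 d2) => [|s]; first by rewrite lt_min d10.
rewrite lt_min => /andP[s1 s2] Ts.
have := lerD (h1 s s1 Ts) (h2 s s2 Ts); rewrite -mulrDl -splitr.
apply: le_trans; apply: le_trans (ler_normD _ _).
by rewrite le_eqVlt; apply/orP; left; apply/eqP; congr (`|_|); ring.
Qed.

Lemma is_delta_deriveZ T (c : R) f t l :
  is_delta_derive T f t l -> is_delta_derive T (fun s => c * f s) t (c * l).
Proof.
move=> /is_delta_deriveP hf; apply/is_delta_deriveP => e e0.
have c0 : 0 < `|c| + 1 by rewrite ltr_wpDl.
have [d d0 h] := hf (e / (`|c| + 1)) (divr_gt0 e0 c0).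
exists d => // s st Ts.
rewrite -mulrA -!mulrBr normrM.
apply: le_trans (ler_wpM2l (normr_ge0 c) (h s st Ts)) _.
rewrite mulrA ler_wpM2r // mulrA ler_pdivrMr // mulrC ler_wpM2l ?ltW //.
by rewrite ltrDl.
Qed.

(** Two derivatives at t are compared at a point s near t with s != sigma t: t
    itself if t is right-scattered, a point beyond t if t is right-dense, and a
    point before t if t is the maximum, which is then left-dense.  On the time
    scale {t} every number is a derivative, hence the second point a. *)
Lemma is_delta_derive_unique T f t l m :
  kappa T t -> (exists2 a, T a & a != t) ->
  is_delta_derive T f t l -> is_delta_derive T f t m -> l = m.
Proof.
move=> kt [a Ta a_t] /is_delta_deriveP hl /is_delta_deriveP hm.
have Tt := kappa_sub T t kt.
have near_ne d : 0 < d -> exists s, [/\ T s, `|t - s| < d & s != sigma T t].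
  move=> d0; have [st|ts] := eqVneq (sigma T t) t; last first.
    by exists t; rewrite subrr normr0 eq_sym.
  have [[b [Tb tb]]|no] := pselect (exists s, T s /\ t < s).
    have [s [Ts ts sb sd]] := sigma_approx T t b d Tb tb d0.
    exists s; rewrite st in sd *; split=> //; last by rewrite gt_eqF.
    by rewrite ltr0_norm; lra.
  have tmax s : T s -> s <= t.
    by move=> Ts; rewrite leNgt; apply/negP => ts; apply: no; exists s.
  have at0 : a < t by rewrite lt_neqAle a_t tmax.
  have rt := kappa_max_left_dense T t kt tmax.
  have [s [Ts ts sd]] := rho_approx T t a d Ta at0 d0.
  exists s; rewrite st; split=> //; last by rewrite lt_eqF.
  by rewrite gtr0_norm; lra.
apply/eqP; rewrite -subr_eq0 -normr_le0; apply/ler_addgt0Pr => e e0.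
have e20 : 0 < e / 2 by lra.
have [d1 d10 h1] := hl _ e20; have [d2 d20 h2] := hm _ e20.
have [|s [Ts]] := near_ne (Num.min d1 d2); first by rewrite lt_min d10.
rewrite lt_min => /andP[s1 s2] s_ne.
have n0 : 0 < `|sigma T t - s| by rewrite normr_gt0 subr_eq0 eq_sym.
rewrite add0r -(ler_pM2r n0) -normrM.
have := lerD (h2 s s2 Ts) (h1 s s1 Ts); rewrite -mulrDl -splitr.
apply: le_trans; apply: le_trans (ler_normB _ _).
by rewrite le_eqVlt; apply/orP; left; apply/eqP; congr (`|_|); ring.
Qed.

(** If f b < f a, tilt f by a small slope e > 0 into h with h b < h a still, and
    choose a level y between h b and h a that h does not take at any exceptional
    point.  Let c be the last time before b at which h is at least y.  If c were
    exceptional it would be right-dense, so h c = y by continuity, against the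
    choice of y.  Hence f has a derivative at c, h increases strictly there, and h
    is at least y at a later time: a contradiction. *)
Lemma delta_derive_ge0_homo T (f : R -> R) (a b : R) :
  closed T -> T a -> T b -> a <= b -> {within T, continuous f} ->
  nearly_everywhere T (fun t => exists2 l, 0 <= l & is_delta_derive T f t l) ->
  f a <= f b.
Proof.
move=> cT Ta Tb ab /subspace_continuousP cf [fin_ex ex_rd].
rewrite leNgt; apply/negP => fba.
have ltab : a < b.
  by rewrite lt_neqAle ab andbT; apply: contraTneq fba => ->; rewrite ltxx.
(* This slope takes back half of the drop f a - f b. *)
pose e := (f a - f b) / (2 * (b - a)).
have e0 : 0 < e by rewrite divr_gt0; lra.
pose h t := f t + e * (t - a).
have hba : h b < h a.
  rewrite /h subrr mulr0 addr0.
  have -> : e * (b - a) = (f a - f b) / 2 by rewrite /e; field; lra.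
  by lra.
have [y [yb ya y_ex]] := avoid_finite R _ _ _ (finite_image h fin_ex) hba.
pose S := [set t | [/\ T t, t <= b & y <= h t]].
have Sa : S a by split=> //; exact: ltW.
have ubS : ubound S b by move=> t [].
have supS : has_sup S by split; [exists a | exists b].
set c := sup S.
have cb : c <= b by apply: ge_sup => //; exists a.
have approx d : 0 < d -> exists s, [/\ S s, s <= c & c - d < s].
  move=> d0; have [s Ss sd] := sup_adherent d0 supS.
  by exists s; split=> //; apply: ub_le_sup => //; exists b.
have Tc : T c.
  apply: closed_approx => // d d0; have [s [[Ts _ _] sc sd]] := approx d d0.
  by exists s => //; rewrite ger0_norm; lra.
have ch d : 0 < d -> exists2 r, 0 < r &
    forall s, `|c - s| < r -> T s -> `|h c - h s| < d.
  move=> d0; have d20 : 0 < d / 2 by lra.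
  have [r r0 hr] := (withinP R T f c (f c)).1 (cf c Tc) _ d20.
  exists (Num.min r (d / 2 / e)) => [|s]; first by rewrite lt_min r0 divr_gt0.
  rewrite lt_min ltr_pdivlMr // => /andP[s1 s2] Ts.
  have -> : h c - h s = (f c - f s) + (c - s) * e by rewrite /h; ring.
  apply: le_lt_trans (ler_normD _ _) _.
  rewrite [ltRHS]splitr ltrD ?hr // normrM (gtr0_norm e0) //.
have yc : y <= h c.
  apply/ler_addgt0Pr => d d0; have [r r0 hr] := ch d d0.
  have [s [[Ts _ ys] sc sd]] := approx r r0.
  have cs : `|c - s| < r by rewrite ger0_norm; lra.
  by have := hr s cs Ts; rewrite ltr_norml => /andP[]; lra.
have ltcb : c < b.
  by rewrite lt_neqAle cb andbT; apply: contraTneq yc => ->; rewrite -ltNge.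
have kc : kappa T c := kappa_lt T c b Tc Tb ltcb.
have beyond s : T s -> c < s -> s <= b -> h s < y.
  move=> Ts cs sb; rewrite ltNge; apply/negP => ys.
  by have : s <= c by [apply: ub_le_sup; [exists b | split]]; rewrite leNgt cs.
have [[l l0 /is_delta_deriveP dl]|nd] :=
    pselect (exists2 l, 0 <= l & is_delta_derive T f c l); last first.
  (* c is exceptional: times beyond c accumulate at c, so h c <= y. *)
  apply: y_ex; exists c => //; apply/eqP; rewrite eq_le yc andbT.
  apply/ler_addgt0Pr => d d0; have [r r0 hr] := ch d d0.
  have sc : sigma T c = c by apply: ex_rd; split.
  have [s [Ts cs sb]] := sigma_approx T c b r Tb ltcb r0; rewrite sc => sr.
  have cs' : `|c - s| < r by rewrite ler0_norm; lra.
  have := hr s cs' Ts; have := beyond s Ts cs sb.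
  by rewrite ltr_norml => ? /andP[]; lra.
have e20 : 0 < e / 2 by lra.
have [d d0 hd] := dl _ e20.
have sb := sigma_le T c b Tb ltcb; have cs := sigma_ge T c.
have [scs|] := ltP c (sigma T c).
  (* The derivative condition at s = c controls the jump from c to sigma c. *)
  have := beyond _ (sigma_in T c cT Tc) scs sb.
  have := hd c; rewrite subrr normr0 => /(_ d0 Tc).
  rewrite (@gtr0_norm _ (sigma T c - c)) ?subr_gt0 // ler_norml /h => /andP[+ _].
  rewrite /h in yc; nra.
move=> sc; have {sc cs}sc : sigma T c = c by apply/eqP; rewrite eq_le sc cs.
have [s [Ts cs sb']] := sigma_approx T c b d Tb ltcb d0; rewrite sc => sd.
have := beyond s Ts cs sb'.
have := hd s; rewrite sc (@ltr0_norm _ (c - s)) ?subr_lt0 //.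
have dcs : - (c - s) < d by lra.
move=> /(_ dcs Ts); rewrite ler_norml => /andP[_].
rewrite /h in yc *; nra.
Qed.

End delta.

(** * Existence of antiderivatives *)

Section minor_functions.
Context {R : realType}.
Context (A : set R) (g : R -> R).

Definition bounded_above_on (s t c : R) :=
  forall q, A q -> s <= q -> q < t -> g q <= c.

(** The minor functions of Perron's integral, with the local condition on the
    derivative replaced by a bound on every increment before t. *)
Definition minor_upto (t : R) (V : R -> R) := forall s r c,
  A s -> A r -> s < r -> r <= t ->
  bounded_above_on s r c -> V r - V s <= c * (r - s).

(** F t is the supremum of V t over the minor functions V up to t that vanish at
    a.  The upper bound on increments passes to the supremum.  For the lower
    bound, following F until s and then the slope c gives a minor function up to
    t, and F dominates it at t. *)
Lemma mean_primitive (a M : R) :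
  A a -> (forall t, A t -> a <= t) -> (forall t, A t -> `|g t| <= M) ->
  exists F : R -> R, forall s t c, A s -> A t -> s < t ->
    (bounded_above_on s t c -> F t - F s <= c * (t - s)) /\
    ((forall q, A q -> s <= q -> q < t -> c <= g q) ->
      c * (t - s) <= F t - F s).
Proof.
move=> Aa amin gM.
pose minors t := [set V t | V in [set V | V a = 0 /\ minor_upto t V]].
pose F t := sup (minors t).
have nonempty t : minors t !=set0.
  (* The line of slope - M is a minor function. *)
  exists (- M * (t - a)); exists (fun q => - M * (q - a)) => //.
  split=> [|s r c As Ar sr rt hc]; first by rewrite subrr mulr0.
  have Mc : - M <= c.
    apply: le_trans (hc s As (lexx s) sr).
    by have := gM s As; rewrite ler_norml => /andP[].
  rewrite -mulrBr; have -> : r - a - (s - a) = r - s by ring.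
  by rewrite ler_wpM2r // subr_ge0 ltW.
have ub t : A t -> ubound (minors t) (M * (t - a)).
  move=> At _ [V [Va mV] <-].
  have [ta|] := ltP a t; last first.
    move=> ta; have -> : t = a by apply/eqP; rewrite eq_le ta amin.
    by rewrite Va subrr mulr0.
  rewrite -[V t]subr0 -Va; apply: mV => // q Aq _ _.
  by have := gM q Aq; rewrite ler_norml => /andP[].
have minor_le t V : A t -> V a = 0 -> minor_upto t V -> V t <= F t.
  move=> At Va mV; apply: ub_le_sup; last by exists V.
  by exists (M * (t - a)); exact: ub.
have minorW s t V : s <= t -> minor_upto t V -> minor_upto s V.
  by move=> st mV p r c Ap Ar pr rs; apply: mV => //; exact: le_trans st.
have F_le s t c : A s -> A t -> s < t -> bounded_above_on s t c ->
    F t - F s <= c * (t - s).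
  move=> As At st hc; rewrite lerBlDr; apply: ge_sup => // _ [V [Va mV] <-].
  rewrite -lerBlDr; apply: le_trans (mV s t c As At st (lexx t) hc).
  by rewrite lerB // minor_le //; apply: minorW mV; exact: ltW.
have Fa : F a = 0.
  apply/eqP; rewrite eq_le; apply/andP; split.
    by have := ge_sup (nonempty a) (ub a Aa); rewrite subrr mulr0.
  apply: (minor_le a (fun=> 0) Aa) => // s r c As Ar sr ra.
  by have := amin s As; rewrite leNgt (lt_le_trans sr ra).
exists F => s t c As At st; split; first exact: F_le.
move=> cg; pose V q := if q <= s then F q else F s + c * (q - s).
have -> : c * (t - s) = V t - F s by rewrite /V leNgt st /=; ring.
rewrite lerB //; apply: minor_le => //; first by rewrite /V amin.
move=> p r c' Ap Ar pr rt hc'; rewrite /V.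
have [rs|sr] := leP r s.
  by rewrite (le_trans (ltW pr) rs); exact: F_le.
have cc' q : A q -> s <= q -> p <= q -> q < r -> c <= c'.
  move=> Aq sq pq qr; apply: le_trans (hc' q Aq pq qr).
  by apply: cg => //; exact: lt_le_trans rt.
have [ps|sp] := leP p s; last first.
  by have := cc' p Ap (ltW sp) (lexx p) pr; nra.
have := cc' s As (lexx s) ps sr.
have [->|ps'] := eqVneq p s; first by nra.
have ltps : p < s by rewrite lt_neqAle ps' ps.
have := F_le p s c' Ap As ltps (fun q Aq pq qs => hc' q Aq pq (lt_trans qs sr)).
nra.
Qed.

End minor_functions.

(** The primitive is that of g extended by 0 outside its domain: the exceptional
    points are right-dense, so no jump starts at one of them, and finitely many,
    so they keep a positive distance from every other point. *)
Lemma delta_primitive_exists (R : realType) (T : set R) (g : pfun R) (a M : R) :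
  closed T -> T a -> (forall t, T t -> a <= t) ->
  (forall t, pdom g t -> `|g t| <= M) ->
  nearly_everywhere T (pdom g) ->
  (forall t, pdom g t -> right_dense T t ->
     g s @[s --> within (pdom g) (nbhs t)] --> g t) ->
  exists2 F : R -> R, {within T, continuous F} &
    nearly_everywhere T (fun t => pdom g t /\ is_delta_derive T F t (g t)).
Proof.
move=> cT Ta amin gM dom_ne g_cont; have [fin_ex _] := dom_ne.
pose g0 t := if `[< pdom g t >] then g t else 0.
have g0E t : pdom g t -> g0 t = g t by rewrite /g0 => gt; rewrite asboolT.
pose M0 := `|M| + 1.
have M00 : 0 < M0 by rewrite ltr_wpDl.
have gM0 t : `|g0 t| <= M0.
  rewrite /g0; case: asboolP => [/gM|_]; last by rewrite normr0 ltW.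
  by move=> /le_trans; apply; have := ler_norm M; rewrite /M0; lra.
have [F hF] := mean_primitive T g0 a M0 Ta amin (fun t _ => gM0 t).
have F_near s t l e : T s -> T t -> s < t ->
    (forall q, T q -> s <= q -> q < t -> `|g0 q - l| <= e) ->
    `|F t - F s - l * (t - s)| <= e * (t - s).
  move=> Ts Tt st hl; have [Fle Fge] :
      F t - F s <= (l + e) * (t - s) /\ (l - e) * (t - s) <= F t - F s.
    have [hle _] := hF s t (l + e) Ts Tt st.
    have [_ hge] := hF s t (l - e) Ts Tt st.
    split; [apply: hle | apply: hge];
      by move=> q Tq sq qt; have := hl q Tq sq qt; rewrite ler_norml => /andP[]; lra.
  by rewrite ler_norml; apply/andP; split; lra.
have F_lip s t : T s -> T t -> `|F t - F s| <= M0 * `|t - s|.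
  have lt_case p q : T p -> T q -> p < q -> `|F q - F p| <= M0 * (q - p).
    move=> Tp Tq pq; rewrite -[F q - F p]subr0 -(mul0r (q - p)).
    by apply: F_near => // r _ _ _; rewrite subr0.
  move=> Ts Tt; have [st|ts|->] := ltgtP s t.
  - by rewrite (gtr0_norm (_ : 0 < t - s)) ?subr_gt0 //; exact: lt_case.
  - rewrite distrC (distrC t) (gtr0_norm (_ : 0 < s - t)) ?subr_gt0 //.
    exact: lt_case.
  - by rewrite !subrr normr0 mulr0.
have F_derive t : kappa T t -> pdom g t -> is_delta_derive T F t (g t).
  move=> kt gt; have Tt := kappa_sub T t kt.
  apply/is_delta_deriveP => e e0; have [st|st] := eqVneq (sigma T t) t.
    have [d1 d10 h1] := (withinP R _ _ _ _).1 (g_cont t gt st) e e0.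
    have [d2 d20 h2] := finite_isolated R _ t fin_ex.
    have close q : T q -> `|t - q| < d1 -> `|t - q| < d2 -> kappa T q ->
        `|g0 q - g t| <= e.
      move=> Tq q1 q2 kq.
      have [->|qt] := eqVneq q t; first by rewrite g0E // subrr normr0 ltW.
      have gq : pdom g q by apply: contrapT => ngq; exact: (h2 q q2 qt).
      by rewrite g0E // distrC ltW // h1.
    exists (Num.min d1 d2) => [|s]; first by rewrite lt_min d10.
    rewrite lt_min st => /andP[s1 s2] Ts; have [lt_st|lt_ts|->] := ltgtP s t.
    - rewrite (gtr0_norm (_ : 0 < t - s)) ?subr_gt0 //.
      rewrite gtr0_norm ?subr_gt0 // in s1 s2.
      apply: F_near => // q Tq sq qt; apply: close => //.
      + by rewrite gtr0_norm; lra.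
      + by rewrite gtr0_norm; lra.
      + exact: kappa_lt qt.
    - rewrite ltr0_norm ?subr_lt0 // in s1 s2.
      rewrite (ltr0_norm (_ : t - s < 0)) ?subr_lt0 //.
      rewrite -normrN; have -> : - (F t - F s - g t * (t - s)) =
        F s - F t - g t * (s - t) by ring.
      rewrite opprB; apply: F_near => // q Tq tq qs; apply: close => //.
      + by rewrite ler0_norm; lra.
      + by rewrite ler0_norm; lra.
      + exact: kappa_lt qs.
    - by rewrite !subrr mulr0 subrr normr0 mulr0.
  have ts : t < sigma T t by rewrite lt_neqAle eq_sym st sigma_ge.
  have jump : F (sigma T t) - F t = g t * (sigma T t - t).
    apply/eqP; rewrite -subr_eq0 -normr_le0.
    rewrite -(mul0r (sigma T t - t)); apply: F_near => //; first exact: sigma_in.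
    move=> q Tq tq qs; have -> : q = t; last by rewrite g0E // subrr normr0.
    apply/eqP; rewrite eq_le tq andbT leNgt; apply/negP => tq'.
    by have := sigma_le T t q Tq tq'; rewrite leNgt qs.
  (* Near t there are only times s <= t.  The error |F t - F s - g t * (t - s)|
     is at most (M0 + |g t|) * (t - s), against e * (sigma t - t). *)
  have den0 : 0 < M0 + `|g t| by rewrite ltr_pwDl.
  exists (Num.min (sigma T t - t) (e * (sigma T t - t) / (M0 + `|g t|))) => [|s].
    by rewrite lt_min subr_gt0 ts divr_gt0 ?mulr_gt0 ?subr_gt0.
  rewrite lt_min ltr_pdivlMr // => /andP[s1 s2] Ts.
  have le_st : s <= t.
    rewrite leNgt; apply/negP => lt_ts; have le_s := sigma_le T t s Ts lt_ts.
    by move: s1; rewrite ler0_norm; lra.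
  have -> : F (sigma T t) - F s - g t * (sigma T t - s) =
      (F t - F s) - g t * (t - s) by move: jump; lra.
  apply: le_trans (ler_normB _ _) _; rewrite normrM.
  have FL := F_lip s t Ts Tt.
  rewrite (gtr0_norm (_ : 0 < sigma T t - s)); last by lra.
  move: s2 FL; rewrite (ger0_norm (_ : 0 <= t - s)) ?subr_ge0 //.
  have : e * (sigma T t - t) <= e * (sigma T t - s) by apply: ler_wpM2l; [exact: ltW | lra].
  lra.
exists F.
  apply/subspace_continuousP => t Tt; apply/withinP => e e0.
  exists (e / M0) => [|s]; first exact: divr_gt0.
  rewrite ltr_pdivlMr // mulrC => ts Ts.
  exact: le_lt_trans (F_lip s t Ts Tt) ts.
apply: nearly_everywhereS dom_ne => t kt gt; split=> //; exact: F_derive.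
Qed.

(** * The delta integral *)

Section integral.
Context {R : realType}.
Implicit Types (T : set R) (F G : R -> R) (g : pfun R).

Lemma delta_increment_le T F G (a b : R) :
  closed T -> T a -> T b -> a <= b ->
  {within T, continuous F} -> {within T, continuous G} ->
  nearly_everywhere T (fun t => exists l m,
    [/\ is_delta_derive T F t l, is_delta_derive T G t m & l <= m]) ->
  F b - F a <= G b - G a.
Proof.
move=> cT Ta Tb ab cF cG FG.
have : G a + - 1 * F a <= G b + - 1 * F b; last by lra.
apply: (delta_derive_ge0_homo T (fun t => G t + - 1 * F t) a b) => //.
  move=> t; apply: cvgD; first exact: cG.
  by apply: cvgM; [exact: cvg_cst | exact: cF].
apply: nearly_everywhereS FG => t _ [l [m [dF dG lm]]].
exists (m + - 1 * l); first by lra.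
by apply: is_delta_deriveD => //; exact: is_delta_deriveZ.
Qed.

Lemma is_delta_integral_unique T g (a b v w : R) :
  closed T -> T a -> T b -> a <= b ->
  is_delta_integral T g a b v -> is_delta_integral T g a b w -> v = w.
Proof.
move=> cT Ta Tb ab [F [cF dF ->]] [G [cG dG ->]].
have FG := nearly_everywhereI _ _ _ dF dG.
apply/eqP; rewrite eq_le; apply/andP; split; apply: (delta_increment_le T) => //;
  by apply: nearly_everywhereS FG => t _ [[_ ?] [_ ?]]; exists (g t), (g t).
Qed.

Lemma within_continuous_linear T (c : R) :
  {within T, continuous (fun s => c * s)}.
Proof. exact: (continuous_subspaceT (@mulrl_continuous R c)). Qed.

(** Stated for any g that is constant on [kappa T], because the values of
    [delta_derive] outside [kappa T] are junk. *)
Lemma prd_continuous_cst T g (c : R) :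
  pdom g = kappa T -> (forall t, kappa T t -> g t = c) -> prd_continuous T g.
Proof.
move=> domg gc.
have cvgc (F : set_system R) : Filter F -> g s @[s --> within (pdom g) F] --> c.
  move=> FF; apply/cvgrPdist_lt => e e0; rewrite near_withinE; near=> s.
  by rewrite domg => ks; rewrite gc // subrr normr0.
split.
- by rewrite domg.
- by rewrite domg setDv.
- by move=> t; rewrite {1}domg => kt _; rewrite (gc t kt); exact: cvgc.
- by move=> t _ _; exists c; exact: cvgc.
- by move=> t; rewrite domg setDv.
Unshelve. all: by end_near. Qed.

Lemma C1prd_linear T (c a b : R) : T a -> T b -> a < b ->
  C1prd T (fun s => c * s).
Proof.
move=> Ta Tb ab; split; first exact: within_continuous_linear.
have d_lin t := is_delta_derive_linear T c t.
apply: (@prd_continuous_cst T _ c) => [|t kt] /=.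
  by apply/seteqP; split=> [t []|t kt] //; split=> //; exists c; exact: d_lin.
apply: xget_subset1; first exact: d_lin.
move=> l m /= dl dm; apply: is_delta_derive_unique kt _ dl dm.
have [ta|ta] := eqVneq a t; last by exists a.
by exists b => //; rewrite -ta gt_eqF.
Qed.

(** The squares of controls with values in [-1, 1] sum to at most 2, and are
    continuous on the common domain at its right-dense points. *)
Lemma delta_integral_sqr_exists T (u1 u2 : pfun R) (a b : R) :
  closed T -> T a -> (forall t, T t -> a <= t) ->
  prd_continuous T u1 -> prd_continuous T u2 ->
  (forall t, pdom u1 t -> -1 <= u1 t <= 1) ->
  (forall t, pdom u2 t -> -1 <= u2 t <= 1) ->
  nearly_everywhere T (pdom u1 `&` pdom u2) ->
  exists v, is_delta_integral T
    (PFun (pdom u1 `&` pdom u2) (fun t => u1 t ^+ 2 + u2 t ^+ 2)) a b v.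
Proof.
move=> cT Ta amin [_ _ c1 _ _] [_ _ c2 _ _] b1 b2 dom12.
set g := PFun _ _.
have [t [/b1 u1t /b2 u2t]||t [d1 d2] rt|F cF dF] :=
    delta_primitive_exists R T g a 2 cT Ta amin.
- by rewrite ger0_norm /=; nra.
- exact: dom12.
- have sub (u : pfun R) : pdom g `<=` pdom u ->
      u s @[s --> within (pdom u) (nbhs t)] --> u t ->
      u s @[s --> within (pdom g) (nbhs t)] --> u t.
    move=> gu /withinP cu; apply/withinP => e e0; have [d d0 hd] := cu e e0.
    by exists d => // s st gs; apply: hd => //; exact: gu.
  have {}c1 := sub u1 (@subIsetl _ _ _) (c1 t d1 rt).
  have {}c2 := sub u2 (@subIsetr _ _ _) (c2 t d2 rt).
  by apply: cvgD; apply: cvgM.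
- by exists (F b - F a), F.
Qed.

End integral.

(** * The optimal control problem *)

Theorem mainTheorem3 (R : realType) (T : set R) (T_ts : time_scale T)
    (T0 : T 0) (T1 : T 1) :
  let K := kappa (ts_interval T 0 1) in
  let u1t := PFun K (fun=> 0) in
  let u2t := PFun K (fun=> 1) in
  let x1t := fun t : R => 2 * t in
  let x2t := fun t : R => t in
  [/\ admissible T x1t x2t u1t u2t,
      cost T u1t u2t = 1
    & forall (x1 x2 : R -> R) (u1 u2 : pfun R),
        admissible T x1 x2 u1 u2 -> 1 <= cost T u1 u2].
Proof.
case: T_ts => _ cT; move=> K u1t u2t x1t x2t.
pose I := ts_interval T 0 1.
have cI : closed I by apply: closedI => //; exact: itv_closed.
have I0 : I 0 by split=> //=; rewrite in_itv /= lexx ler01.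
have I1 : I 1 by split=> //=; rewrite in_itv /= lexx ler01.
have Imin t : I t -> 0 <= t by case=> _ /=; rewrite in_itv /= => /andP[].
have x2tE : x2t = (fun s => 1 * s) by apply/funext => s; rewrite mul1r.
split.
- split.
  + by rewrite x2tE; split; exact: (C1prd_linear I _ 0 1).
  + split; first exact: (@prd_continuous_cst R I _ 0).
    exact: (@prd_continuous_cst R I _ 1).
  + by split=> t _ /=; lra.
  + apply: nearly_everywhereT => t kt; split=> //=.
      by rewrite expR0 addr0; exact: is_delta_derive_linear.
    by rewrite x2tE; exact: is_delta_derive_linear.
  + by rewrite /x1t /x2t mulr0 mulr1.
- have int1 : is_delta_integral I (PFun (pdom u1t `&` pdom u2t)
      (fun t => u1t t ^+ 2 + u2t t ^+ 2)) 0 1 1.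
    exists (fun s => 1 * s); split; last by rewrite mulr1 mulr0 subr0.
      exact: within_continuous_linear.
    apply: nearly_everywhereT => t kt; split=> //=.
    by rewrite expr0n expr1n add0r; exact: is_delta_derive_linear.
  apply: xget_subset1 => // v w.
  by apply: is_delta_integral_unique => //; exact: ler01.
move=> x1 x2 u1 u2 [[_ [cx2 _]] [prd1 prd2] [b1 b2] ode [_ _ x20 x21]].
have dom12 : nearly_everywhere I (pdom u1 `&` pdom u2).
  by apply: nearly_everywhereS ode => t _ [].
have ex := delta_integral_sqr_exists I u1 u2 0 1 cI I0 Imin prd1 prd2 b1 b2 dom12.
have [F [cF dF costE]] := xgetPex 0 ex.
rewrite /cost /delta_integral costE.
(* The antiderivative of 2 * u2 - 1. *)
pose G t := 2 * x2 t + - 1 * t.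
have G01 : 1 = G 1 - G 0 by rewrite /G x20 x21; ring.
rewrite [leLHS]G01.
apply: (delta_increment_le I) => //.
  move=> t; apply: cvgD; last exact: within_continuous_linear.
  by apply: cvgM; [exact: cvg_cst | exact: cx2].
have both := nearly_everywhereI _ _ _ ode dF.
apply: nearly_everywhereS both => t _ [[_ _ _ dx2] [_ dFt]].
exists (2 * u2 t + - 1), (u1 t ^+ 2 + u2 t ^+ 2); split=> //.
  apply: is_delta_deriveD; first exact: is_delta_deriveZ.
  exact: is_delta_derive_linear.
have := sqr_ge0 (u1 t); have := sqr_ge0 (u2 t - 1); nra.
Qed.
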